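(* Let $l \ge 200$ be an even integer and $d = 4l$. For $T\subseteq[d]$ write $e_T\in\{0,1\}^d$ for the indicator vector of $T$. Let the demonstration set $D$ consist of all vectors $e_{T_1\cup T_2}$ with $T_1\subseteq[2l]$, $|T_1| = l/2$, and $T_2\subseteq\{2l+1,\dots,4l\}$, $|T_2| = l/2$ (i.e. $D$ is the entire support of the demonstration distribution $\mathcal D_{\mathcal E}$, which draws $T_1,T_2$ uniformly). Let the query $e_q = e_T$ with $T$ drawn uniformly among subsets of $[2l]$ of size $l$. Let $\theta\in\mathbb R^d$ have i.i.d. entries uniform on $[0,1]$, independent of $e_q$, and let $K=2$. Let $L$ be the expected prediction loss $\mathbb E\big[\langle \theta - E^\dagger E\theta, e_q\rangle^2\big]$ when the two demonstrations (rows of $E$) are selected by TopK, and $L'$ the same quantity when they are selected by TopK-Div with hyperparameter $\alpha$, where the expectation is over $\theta$, $e_q$, and the random tie-breaking in the selection. Then $L > L'$ for every $\alpha\in(0,1)$.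
   Context: Cosine similarity: $\mathrm{Sim}(u,v) = \langle u,v\rangle/(\|u\|\|v\|)$. For a vector $e$ and a nonempty finite set $S$ of vectors, $\mathrm{Div}(e,S) = 1 - \frac{1}{|S|}\sum_{s\in S}\mathrm{Sim}(e,s)$, and $\mathrm{Div}(e,\emptyset)=0$. TopK selection: choose the $K$ elements of $D$ with the largest $\mathrm{Sim}(\cdot,e_q)$, ties broken uniformly at random. TopK-Div selection with parameter $\alpha$: start with $S=\emptyset$ and, while $|S|<K$, add an element $e\in D\setminus S$ maximizing $\alpha\,\mathrm{Sim}(e,e_q) + (1-\alpha)\mathrm{Div}(e,S)$ (ties broken uniformly at random); in particular the first selected element maximizes similarity to $e_q$. Given the selected demonstrations $e_{j_1},\dots,e_{j_K}$, $E = [e_{j_1},\dots,e_{j_K}]^\top\in\mathbb R^{K\times d}$, $E^\dagger$ is its Moore–Penrose pseudoinverse, the model's prediction on query $e_q$ is $\langle e_q, E^\dagger E\theta\rangle$ (the min-norm interpolating linear regression solution), the true label is $\langle\theta,e_q\rangle$, and the prediction loss is $\langle \theta - E^\dagger E\theta, e_q\rangle^2$. *)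

(* Defs.v *)
From HB Require Import structures.
From mathcomp Require Import all_boot all_order all_algebra.
From mathcomp Require Import all_classical all_reals all_analysis.
Set Implicit Arguments. Unset Strict Implicit. Unset Printing Implicit Defensive.
Import Order.TTheory GRing.Theory Num.Theory.
Import numFieldNormedType.Exports.
Local Open Scope ring_scope.

Section Defs.
Variable R : realType.

Definition dotv n (u v : 'rV[R]_n) : R := \sum_(i < n) u 0 i * v 0 i.
Definition normv n (u : 'rV[R]_n) : R := Num.sqrt (dotv u u).
Definition Sim n (u v : 'rV[R]_n) : R := dotv u v / (normv u * normv v).
Definition Div n (e : 'rV[R]_n) (S : seq 'rV[R]_n) : R :=
  if S is [::] then 0
  else 1 - (\sum_(s <- S) Sim e s) / (size S)%:R.

Definition penrose m n (E : 'M[R]_(m, n)) (X : 'M[R]_(n, m)) : Prop :=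
  [/\ E *m X *m E = E, X *m E *m X = X,
      (E *m X)^T = E *m X & (X *m E)^T = X *m E].
Definition pinv m n (E : 'M[R]_(m, n)) : 'M[R]_(n, m) :=
  xget 0 [set X | penrose E X].

Definition rows_mx n (s : seq 'rV[R]_n) : 'M[R]_(size s, n) :=
  \matrix_(k < size s, j < n) (nth 0 s k) 0 j.

Definition pred_loss n (s : seq 'rV[R]_n) (theta eq : 'rV[R]_n) : R :=
  let E := rows_mx s in
  let Ptheta := ((pinv E *m E) *m theta^T)^T in
  (dotv (theta - Ptheta) eq) ^+ 2.

(* ---------- expectation over theta with i.i.d. Unif[0,1] coordinates:
   iterated Lebesgue integral over [0,1] of coordinates n-1, ..., 0 ---------- *)
Definition upd (x : nat -> R) (m : nat) (t : R) : nat -> R :=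
  fun i => if i == m then t else x i.
Fixpoint cube_int (n : nat) (f : (nat -> R) -> R) (x : nat -> R) : R :=
  match n with
  | 0 => f x
  | m.+1 => \int[@lebesgue_measure R]_(t in `[0%R, 1%R]%classic)
              cube_int m f (upd x m t)
  end.
Definition E_theta (n : nat) (f : 'rV[R]_n -> R) : R :=
  cube_int n (fun x => f (\row_(i < n) x i)) (fun _ => 0).

(* ---------- selection rules over a finite pool A of indices, vec : I -> R^n,
   returning the expectation of g over the random tie-breaking ---------- *)
Section Selection.
Variables (I : finType) (n : nat) (vec : I -> 'rV[R]_n) (A : {set I}).

Definition topk_sets (K : nat) (eq : 'rV[R]_n) : {set {set I}} :=
  [set S : {set I} | [&& S \subset A, #|S| == K &
     [forall x in S, forall y in A :\: S, Sim (vec y) eq <= Sim (vec x) eq]]].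
Definition topk_avg (K : nat) (eq : 'rV[R]_n) (g : seq I -> R) : R :=
  (#|topk_sets K eq|%:R)^-1 * \sum_(S in topk_sets K eq) g (enum S).

Fixpoint greedy_avg (K : nat) (score : seq I -> I -> R) (S : seq I)
    (g : seq I -> R) : R :=
  match K with
  | 0 => g S
  | k.+1 =>
    let C := [set i in A | i \notin S] in
    let M := [set i in C | [forall j in C, score S j <= score S i]] in
    (#|M|%:R)^-1 * \sum_(i in M) greedy_avg k score (rcons S i) g
  end.

Definition topkdiv_score (alpha : R) (eq : 'rV[R]_n) (S : seq I) (e : I) : R :=
  alpha * Sim (vec e) eq + (1 - alpha) * Div (vec e) (map vec S).
Definition topkdiv_avg (K : nat) (alpha : R) (eq : 'rV[R]_n) (g : seq I -> R) : R :=
  greedy_avg K (topkdiv_score alpha eq) [::] g.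
End Selection.

Section Instance.
Variable l : nat.
Notation d := (4 * l)%N.

(* indicator vector e_T ; 'I_d = {0,...,d-1} stands for [d] = {1,...,d} *)
Definition ind (T : {set 'I_d}) : 'rV[R]_d := \row_(i < d) (if i \in T then 1 else 0).
Definition lowhalf : {set 'I_d} := [set i : 'I_d | (i < 2 * l)%N].
Definition highhalf : {set 'I_d} := [set i : 'I_d | (2 * l <= i)%N].

Definition demoD : {set {set 'I_d}} :=
  [set T : {set 'I_d} | [exists T1 : {set 'I_d}, exists T2 : {set 'I_d},
     [&& T1 \subset lowhalf, #|T1| == l./2, T2 \subset highhalf,
         #|T2| == l./2 & T == T1 :|: T2]]].
Definition querySet : {set {set 'I_d}} :=
  [set T : {set 'I_d} | (T \subset lowhalf) && (#|T| == l)].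

Definition avg_query (h : {set 'I_d} -> R) : R :=
  (#|querySet|%:R)^-1 * \sum_(T in querySet) h T.

Definition loss_of (Tq : {set 'I_d}) (s : seq {set 'I_d}) : R :=
  E_theta (fun theta => pred_loss (map ind s) theta (ind Tq)).

Definition L_topk (K : nat) : R :=
  avg_query (fun Tq => topk_avg ind demoD K (ind Tq) (loss_of Tq)).
Definition L_topkdiv (K : nat) (alpha : R) : R :=
  avg_query (fun Tq => topkdiv_avg ind demoD K alpha (ind Tq) (loss_of Tq)).
End Instance.
End Defs.

(* Main.v *)
(** Let A, B be the two selected demonstrations (as subsets of [4l]) and c the
    number of indices they share.  Both rules only select demonstrations whose
    low part (indices up to 2l) lies in the query T, so
    <e_A, e_T> = <e_B, e_T> = l/2 and the projection of e_T onto
    span(e_A, e_B) is a (e_A + e_B) with a = l / (2 (l + c)).  The loss is then the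
    second moment of <theta, r> for the residual r = e_T - a (e_A + e_B), namely
    (l c / (l + c))^2 / 4 + l (l + 2 c) / (24 (l + c)), which is smallest exactly
    at c = 0.  TopK-Div always reaches c = 0, since A can be followed by the
    demonstration with low part T \ A and high part disjoint from A, which is at
    once optimal for similarity and for diversity.  TopK selects pairs with c > 0
    with positive probability. *)
Require Import Defs.
From mathcomp Require Import all_boot all_order all_algebra.
From mathcomp Require Import all_classical all_reals all_analysis.
From mathcomp Require Import zify ring lra.
Set Implicit Arguments.
Unset Strict Implicit.
Unset Printing Implicit Defensive.
Import Order.TTheory GRing.Theory Num.Theory.
Import numFieldNormedType.Exports.
Local Open Scope ring_scope.

(** * Second moments of linear forms on the unit cube *)

Lemma Rintegral01_sqr_affine (R : realType) (a b c : R) :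
  \int[@lebesgue_measure R]_(t in `[0%R, 1%R]%classic) ((a + b * t) ^+ 2 + c)
  = (a + b / 2) ^+ 2 + b ^+ 2 / 12 + c.
Proof.
(* [p] is an antiderivative of the integrand, obtained by expanding the square. *)
pose p : {poly R} :=
  (a ^+ 2 + c) *: 'X + (a * b) *: 'X^2 + (b ^+ 2 / 3) *: 'X^3.
have p'E t : p^`().[t] = (a + b * t) ^+ 2 + c.
  by rewrite /p !poly.derivE !(hornerE, hornerMn) /=; field.
have cp : continuous (horner p) by apply: continuous_horner.
rewrite /Rintegral (@continuous_FTC2 _ _ (horner p)) //=.
- by rewrite /p !hornerE /=; field.
- apply: continuous_subspaceT => x.
  by rewrite -(funext p'E); apply: continuous_horner.
- split=> [x _||]; first exact: derivable_horner.
  + exact/cvg_at_right_filter/cp.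
  + exact/cvg_at_left_filter/cp.
- by move=> x _; rewrite -derivE.
Qed.

Lemma eq_cube_int (R : realType) n (f g : (nat -> R) -> R) x :
  f =1 g -> cube_int n f x = cube_int n g x.
Proof. by move=> /funext ->. Qed.

(** Integrating out one coordinate replaces it by its mean 1/2 and adds its variance 1/12 times
    [r i ^+ 2]. Keeping [N] fixed while [m] grows leaves the coordinates from [m] on frozen at [x],
    which is the form the induction needs. *)
Lemma cube_int_sqr_linear (R : realType) N (r : nat -> R) m (x : nat -> R) :
  (m <= N)%N ->
  cube_int m (fun y => (\sum_(0 <= i < N) y i * r i) ^+ 2) x =
  ((\sum_(0 <= i < m) r i) / 2 + \sum_(m <= i < N) x i * r i) ^+ 2
  + (\sum_(0 <= i < m) r i ^+ 2) / 12.
Proof.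
elim: m x => [|m IHm] x leNm /=.
  by rewrite !(big_geq (leqnn 0)) !mul0r add0r addr0.
(* Isolate coordinate [m]: the integrand is the square of an affine function of [t] plus a constant,
   and the later coordinates are untouched by [upd]. *)
under eq_Rintegral => t _.
  rewrite IHm ?(ltnW leNm) // (big_ltn leNm) /upd eqxx.
  rewrite (@eq_big_nat _ _ _ m.+1 N _ (fun i => x i * r i)); last first.
    by move=> i /andP[lt_mi _]; rewrite gtn_eqF.
  rewrite [t * r m]mulrC [r m * t + _]addrC addrA.
  over.
by rewrite Rintegral01_sqr_affine !big_nat_recr //=; field.
Qed.

Lemma E_theta_sqr_linear (R : realType) n (r : 'rV[R]_n) :
  E_theta (fun theta => dotv theta r ^+ 2) =
  (\sum_i r 0 i) ^+ 2 / 4 + (\sum_i r 0 i ^+ 2) / 12.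
Proof.
rewrite /E_theta.
(* [r'] extends [r] by zero to all naturals, since [cube_int] works with sequences. *)
pose r' i := oapp (r 0) 0 (insub i : option 'I_n).
have r'E (i : 'I_n) : r' i = r 0 i by rewrite /r' valK.
under eq_cube_int => x.
  rewrite /dotv (eq_bigr (fun i : 'I_n => x i * r' i)); last first.
    by move=> i _; rewrite mxE r'E.
  rewrite -(big_mkord xpredT (fun i => x i * r' i)).
  over.
rewrite cube_int_sqr_linear // (big_geq (leqnn n)) !big_mkord addr0.
under eq_bigr do rewrite r'E.
under [X in _ + X / _]eq_bigr do rewrite r'E.
by rewrite exprMn; field.
Qed.

(** * The pseudoinverse and the residual form of the loss *)

Lemma gram_unitmx (R : realType) m n (B : 'M[R]_(m, n)) :
  row_free B -> B *m B^T \in unitmx.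
Proof.
move=> freeB; rewrite -row_free_unit; apply/inj_row_free => v vBB.
apply: (row_free_inj freeB); rewrite mul0mx; set u := v *m B.
(* Multiplying [v *m B *m B^T = 0] by [v^T] gives a vanishing sum of squares. *)
have uuE : \sum_i u 0 i ^+ 2 = 0.
  transitivity ((u *m u^T) 0 0); last first.
    by rewrite trmx_mul mulmxA -(mulmxA v) vBB mul0mx mxE.
  by rewrite mxE; apply: eq_bigr => i _; rewrite [u^T _ _]mxE expr2.
apply/rowP => j; rewrite [RHS]mxE; apply/eqP; rewrite -sqrf_eq0.
by rewrite (psumr_eq0P _ uuE) // => i _; apply: sqr_ge0.
Qed.

(** [xget] falls back on 0 when no matrix satisfies the Penrose equations, so a solution has to be
    exhibited. *)
Lemma pinvP (R : realType) m n (E : 'M[R]_(m, n)) : penrose E (Defs.pinv E).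
Proof.
rewrite /Defs.pinv; case: xgetP => [X -> //|noX]; exfalso.
(* A rank factorization E = C B gives B^T (B B^T)^-1 (C^T C)^-1 C^T. *)
have [k [C [B [EE freeB fullC]]]] :
    exists k (C : 'M[R]_(m, k)) (B : 'M[R]_(k, n)),
      [/\ E = C *m B, row_free B & row_full C].
  exists (\rank E), (col_base E), (row_base E).
  by rewrite mulmx_base; split; [|exact: row_base_free|exact: col_base_full].
subst E.
have uB : B *m B^T \in unitmx by apply: gram_unitmx.
have uC : C^T *m C \in unitmx.
  rewrite -{2}(trmxK C); apply: gram_unitmx.
  by rewrite /row_free mxrank_tr.
set GB := B *m B^T in uB; set GC := C^T *m C in uC.
have GBt : (invmx GB)^T = invmx GB by rewrite trmx_inv /GB trmx_mul trmxK.
have GCt : (invmx GC)^T = invmx GC by rewrite trmx_inv /GC trmx_mul trmxK.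
pose X := B^T *m invmx GB *m invmx GC *m C^T.
have EX : C *m B *m X = C *m invmx GC *m C^T.
  by rewrite /X !mulmxA -(mulmxA C B) -/GB mulmxK.
have XE : X *m (C *m B) = B^T *m invmx GB *m B.
  by rewrite /X !mulmxA -(mulmxA _ C^T C) -/GC mulmxKV.
apply: (noX X); split.
- by rewrite EX !mulmxA -(mulmxA _ C^T C) -/GC mulmxKV.
- by rewrite XE /X !mulmxA -(mulmxA _ B B^T) -/GB mulmxKV.
- by rewrite EX !trmx_mul GCt trmxK mulmxA.
- by rewrite XE !trmx_mul GBt trmxK mulmxA.
Qed.

(** The matrix [P] (pseudoinverse times [E]) is symmetric, fixes the row space of [E] and kills [r].
    Moving it across the inner product leaves only the component [r] of the query. Linearly
    dependent rows are covered as well. *)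
Lemma pred_loss_orthogonal (R : realType) n (s : seq 'rV[R]_n)
    (w : 'rV[R]_(size s)) (theta q r : 'rV[R]_n) :
  q = w *m rows_mx s + r -> rows_mx s *m r^T = 0 ->
  pred_loss s theta q = dotv theta r ^+ 2.
Proof.
move=> qE Er0; rewrite /pred_loss /=; set E := rows_mx s in w qE Er0 *.
have [EXE _ _ symXE] := pinvP E.
set P := Defs.pinv E *m E in symXE *.
have dotE (u v : 'rV[R]_n) : dotv u v = (u *m v^T) 0 0.
  by rewrite mxE; apply: eq_bigr => i _; rewrite mxE.
rewrite !dotE trmx_mul trmxK symXE; congr (_ ^+ 2); congr (fun_of_matrix _ 0 0).
have Pr : P *m r^T = 0 by rewrite -mulmxA Er0 mulmx0.
have PE : P *m E^T = E^T by rewrite -symXE -trmx_mul mulmxA EXE.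
rewrite mulmxBl -(mulmxA theta) qE linearD /= trmx_mul !mulmxDr.
by rewrite Pr mulmx0 addr0 (mulmxA P) PE addrAC subrr add0r.
Qed.

(** * Indicator vectors and the loss of a pair of demonstrations *)

Lemma dotvC (R : realType) n (u v : 'rV[R]_n) : dotv u v = dotv v u.
Proof. by apply: eq_bigr => i _; rewrite mulrC. Qed.

Lemma dotvDl (R : realType) n (u v w : 'rV[R]_n) :
  dotv (u + v) w = dotv u w + dotv v w.
Proof. by rewrite -big_split; apply: eq_bigr => i _; rewrite mxE mulrDl. Qed.

Lemma dotvZl (R : realType) n a (u v : 'rV[R]_n) :
  dotv (a *: u) v = a * dotv u v.
Proof. by rewrite /dotv mulr_sumr; apply: eq_bigr => i _; rewrite mxE mulrA. Qed.

Lemma dotvBl (R : realType) n (u v w : 'rV[R]_n) :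
  dotv (u - v) w = dotv u w - dotv v w.
Proof. by rewrite -(scaleN1r v) dotvDl dotvZl mulN1r. Qed.

Lemma dotv_ind (R : realType) l (A B : {set 'I_(4 * l)}) :
  dotv (ind R A) (ind R B) = #|A :&: B|%:R.
Proof.
rewrite -sum1_card natr_sum [RHS]big_mkcond; apply: eq_bigr => i _.
by rewrite !mxE inE; case: (i \in A); case: (i \in B);
  rewrite ?mulr0 ?mul0r ?mulr1.
Qed.

Lemma Sim_ind (R : realType) l (A B : {set 'I_(4 * l)}) :
  #|A| = l -> #|B| = l -> Sim (ind R A) (ind R B) = #|A :&: B|%:R / l%:R.
Proof.
move=> cA cB; rewrite /Sim /normv !dotv_ind !finset.setIid cA cB.
by rewrite -expr2 sqr_sqrtr.
Qed.

(** Squared mean plus variance of the linear form given by the residual, whose coordinate sum is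
    [l * c / (l + c)] and whose squared norm is [l * (l + 2 * c) / (2 * (l + c))]. *)
Definition pair_loss (R : realType) (l c : R) : R :=
  (l * c / (l + c)) ^+ 2 / 4 + l * (l + 2 * c) / (l + c) / 24.

Lemma pair_loss_lt (R : realType) (l c : R) :
  0 < l -> 0 < c -> pair_loss l 0 < pair_loss l c.
Proof.
move=> l0 c0; rewrite -subr_gt0.
have -> : pair_loss l c - pair_loss l 0 =
    (l * c / (l + c)) ^+ 2 / 4 + l * c / (l + c) / 24.
  by rewrite /pair_loss; field; lra.
have : 0 < l * c / (l + c) by rewrite divr_gt0 ?mulr_gt0 ?addr_gt0.
by set x := _ / _ => x0; nra.
Qed.

Lemma pair_loss_le (R : realType) (l c : R) :
  0 < l -> 0 <= c -> pair_loss l 0 <= pair_loss l c.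
Proof.
move=> l0; rewrite le_eqVlt => /predU1P[<- //|c0].
exact/ltW/pair_loss_lt.
Qed.

Lemma loss_of_pair (R : realType) l (T A B : {set 'I_(4 * l)}) :
  (0 < l)%N -> #|T| = l -> #|A| = l -> #|B| = l ->
  (#|A :&: T|.*2 = l)%N -> (#|B :&: T|.*2 = l)%N ->
  loss_of R T [:: A; B] = pair_loss l%:R #|A :&: B|%:R.
Proof.
move=> l_gt0 cT cA cB cAT cBT.
move LE: (l%:R : R) => L; move cE: (#|A :&: B|%:R : R) => c.
have L0 : 0 < L by rewrite -LE ltr0n.
have c0 : 0 <= c by rewrite -cE ler0n.
have Lc0 : L + c != 0 by rewrite gt_eqF // ltr_wpDr.
have halfE (X : {set 'I_(4 * l)}) : #|X :&: T|.*2 = l -> #|X :&: T|%:R = L / 2 :> R.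
  by move=> /(congr1 (fun n => n%:R : R)); rewrite -muln2 natrM LE; lra.
(* Orthogonality of [r] to both indicators is the single equation [L / 2 = a * (L + c)]. *)
pose a := L / (2 * (L + c)).
pose r := ind R T - a *: (ind R A + ind R B).
have uu (X : {set 'I_(4 * l)}) : #|X| = l -> dotv (ind R X) (ind R X) = L.
  by move=> h; rewrite dotv_ind finset.setIid h LE.
have uv : dotv (ind R A) (ind R B) = c by rewrite dotv_ind cE.
have ut : dotv (ind R A) (ind R T) = L / 2 by rewrite dotv_ind halfE.
have vt : dotv (ind R B) (ind R T) = L / 2 by rewrite dotv_ind halfE.
have ru : dotv r (ind R A) = 0.
  rewrite dotvBl dotvZl dotvDl (dotvC (ind R T)) ut uu // (dotvC _ (ind R A)) uv.
  by rewrite /a; field.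
have rv : dotv r (ind R B) = 0.
  rewrite dotvBl dotvZl dotvDl (dotvC (ind R T)) vt uu // uv.
  by rewrite /a; field.
(* As [r] is orthogonal to both demonstrations, its squared norm is its inner product with the
   query. *)
have rr : dotv r r = L - a * L.
  rewrite {2}/r dotvC dotvBl dotvZl dotvDl !(dotvC _ r) ru rv addr0 mulr0 subr0.
  by rewrite dotvBl dotvZl dotvDl uu // ut vt; field.
(* Coordinate sums are inner products with the all-ones vector. *)
have sumE (X : {set 'I_(4 * l)}) : #|X| = l -> dotv (ind R X) (const_mx 1) = L.
  move=> h; rewrite -LE; transitivity (#|X|%:R : R); last by rewrite h.
  rewrite -sum1_card natr_sum [RHS]big_mkcond; apply: eq_bigr => i _.
  by rewrite !mxE mulr1.
have sr : dotv r (const_mx 1) = L - a * (L + L).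
  by rewrite dotvBl dotvZl dotvDl !sumE.
rewrite /loss_of /E_theta.
transitivity (E_theta (fun theta => dotv theta r ^+ 2)).
  apply: eq_cube_int => x.
  apply: (@pred_loss_orthogonal _ _ [:: ind R A; ind R B] (const_mx a)).
    have -> : const_mx a *m rows_mx [:: ind R A; ind R B] =
        a *: (ind R A + ind R B).
      apply/rowP => j; rewrite mxE !big_ord_recl big_ord0 addr0.
      by rewrite !mxE /= mulrDr.
    by rewrite addrC subrK.
  apply/matrixP => i j; rewrite ord1 mxE [RHS]mxE.
  transitivity (dotv r (nth 0 [:: ind R A; ind R B] i)).
    by rewrite dotvC; apply: eq_bigr => k _; rewrite [rows_mx _ _ _]mxE [r^T _ _]mxE.
  by case: i => [[|[|]]].
rewrite E_theta_sqr_linear.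
have -> : \sum_i r 0 i = dotv r (const_mx 1).
  by apply: eq_bigr => i _; rewrite [const_mx _ _ _]mxE mulr1.
have -> : \sum_i r 0 i ^+ 2 = dotv r r by apply: eq_bigr => i _; rewrite expr2.
by rewrite sr rr /pair_loss /a; field.
Qed.

(** * Combinatorics of the demonstration set *)

Lemma subset_of_card (T : finType) (X : {set T}) k :
  (k <= #|X|)%N -> exists2 Y : {set T}, Y \subset X & #|Y| = k.
Proof.
rewrite -bin_gt0 -cards_draws card_gt0 => /set0Pn[Y].
by rewrite inE => /andP[sYX /eqP cY]; exists Y.
Qed.

Lemma highhalfE l : highhalf l = ~: lowhalf l.
Proof. by apply/setP => i; rewrite !inE leqNgt. Qed.

Lemma card_lowhalf l : #|lowhalf l| = (2 * l)%N.
Proof.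
have le24 : (2 * l <= 4 * l)%N by rewrite leq_mul2r orbT.
by rewrite -sum1dep_card (big_ord_narrow le24) sum1_card card_ord.
Qed.

Lemma card_highhalf l : #|highhalf l| = (2 * l)%N.
Proof.
have := cardsC (lowhalf l); rewrite -highhalfE card_lowhalf card_ord; lia.
Qed.

(** The two halves are complementary, so the witnesses [T1] and [T2] can only be the traces of [A]
    on them. *)
Lemma demoDP l (A : {set 'I_(4 * l)}) :
  reflect (#|A :&: lowhalf l| = l./2 /\ #|A :&: highhalf l| = l./2)
    (A \in demoD l).
Proof.
rewrite inE; apply: (iffP existsP) => [[T1 /existsP[T2]]|[cl ch]].
  move=> /and5P[s1 /eqP c1 s2 /eqP c2 /eqP ->].
  have d12 : [disjoint lowhalf l & highhalf l].
    by rewrite highhalfE finset.disjoints_subset finset.setCK.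
  rewrite !finset.setIUl (finset.setIidPl s1) (finset.setIidPl s2).
  have /disjoint_setI0 -> : [disjoint T2 & lowhalf l].
    by rewrite disjoint_sym; apply: disjointWr d12.
  have /disjoint_setI0 -> : [disjoint T1 & highhalf l].
    by apply: disjointWl d12.
  by rewrite finset.setU0 finset.set0U.
exists (A :&: lowhalf l); apply/existsP; exists (A :&: highhalf l).
rewrite !finset.subsetIr cl ch !eqxx /= -finset.setIUr highhalfE.
by rewrite finset.setUCr finset.setIT.
Qed.

Lemma card_demo l (A : {set 'I_(4 * l)}) : ~~ odd l -> A \in demoD l -> #|A| = l.
Proof.
move=> evl /demoDP[cl ch]; rewrite -(cardsID (lowhalf l)) cl.
by rewrite finset.setDE -highhalfE ch addnn even_halfK.
Qed.

Lemma card_demo_query l (A T : {set 'I_(4 * l)}) :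
  A \in demoD l -> T \in querySet l -> (#|A :&: T| <= l./2)%N.
Proof.
move=> /demoDP[<- _]; rewrite inE => /andP[sT _].
by apply: subset_leq_card; apply: finset.setIS.
Qed.

(** The high half has [2 * l] indices and [X] occupies at most [l./2] of them, which leaves room for
    a high part avoiding [X]. The choice of [T1] then controls the overlap with [X]. *)
Lemma exists_demo l (X T T1 : {set 'I_(4 * l)}) :
  T \in querySet l -> (#|X :&: highhalf l| <= l./2)%N ->
  T1 \subset T -> #|T1| = l./2 ->
  exists B, [/\ B \in demoD l, B :&: T = T1 & B :&: X = T1 :&: X].
Proof.
rewrite inE => /andP[sT _] cX sT1 cT1.
have [|T2 sT2 cT2] := @subset_of_card _ (highhalf l :\: X) l./2.
  have := cardsID X (highhalf l); rewrite card_highhalf finset.setIC; lia.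
have sT2h : T2 \subset highhalf l := fintype.subset_trans sT2 (finset.subsetDl _ _).
have notlow i : i \in T2 -> i \notin lowhalf l.
  by move/(fintype.subsetP sT2h); rewrite highhalfE inE.
exists (T1 :|: T2); split.
- rewrite inE; apply/existsP; exists T1; apply/existsP; exists T2.
  by rewrite (fintype.subset_trans sT1 sT) cT1 cT2 sT2h !eqxx.
- apply/setP => i; rewrite !inE; case: (boolP (i \in T1)).
    by move/(fintype.subsetP sT1).
  move=> _ /=.
  by apply/negP => /andP[/notlow/negP nl /(fintype.subsetP sT)].
- apply/setP => i; rewrite !inE; case: (boolP (i \in T1)) => //= _.
  by apply/negP => /andP[/(fintype.subsetP sT2)]; rewrite inE => /andP[/negP].
Qed.

(** * Averages over tie-breaking *)

Lemma avg_const (R : realType) (I : finType) (M : {set I}) (F : I -> R) x :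
  M != finset.set0 -> (forall i, i \in M -> F i = x) ->
  (#|M|%:R)^-1 * \sum_(i in M) F i = x.
Proof.
move=> M0 Fx; rewrite (eq_bigr (fun=> x)) // sumr_const -[x *+ _]mulr_natl mulKf //.
by rewrite pnatr_eq0 cards_eq0.
Qed.

Lemma avg_gt (R : realType) (I : finType) (M : {set I}) (F : I -> R) x i0 :
  (forall i, i \in M -> x <= F i) -> i0 \in M -> x < F i0 ->
  x < (#|M|%:R)^-1 * \sum_(i in M) F i.
Proof.
move=> xF Mi0 xF0; have M0 : (0 < #|M|)%N by apply/card_gt0P; exists i0.
rewrite mulrC ltr_pdivlMr ?ltr0n // mulr_natr -sumr_const.
rewrite (bigD1 i0) //= [ltRHS](bigD1 i0) //= ltr_leD // ler_sum // => i.
by move=> /andP[/xF].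
Qed.

(** The candidate [i0] makes the pool nonempty, so a maximizer exists and the average is a genuine
    one; it is constant when every maximizer leads to [x]. *)
Lemma greedy_avgS_const (R : realType) (I : finType) (A : {set I}) k
    (score : seq I -> I -> R) S g x i0 :
  i0 \in A -> i0 \notin S ->
  (forall i, i \in A -> i \notin S ->
     (forall j, j \in A -> j \notin S -> score S j <= score S i) ->
     greedy_avg A k score (rcons S i) g = x) ->
  greedy_avg A k.+1 score S g = x.
Proof.
move=> Ai0 Si0 gx /=; apply: avg_const => [|i].
  have Ci0 : i0 \in [set i in A | i \notin S] by rewrite inE Ai0.
  case: (arg_maxP (score S) Ci0) => i Ci max_i.
  apply/set0Pn; exists i; rewrite inE; apply/andP; split=> //.
  by apply/forall_inP => j /max_i.
rewrite !inE => /andP[/andP[Ai Si] /forall_inP max_i].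
by apply: gx => // j Aj Sj; apply: max_i; rewrite inE Aj.
Qed.

(** * The two selection rules for a fixed query *)

Section Fixed_query.
Variables (R : realType) (l : nat) (T : {set 'I_(4 * l)}).
Hypotheses (l_gt1 : (1 < l)%N) (evl : ~~ odd l) (qT : T \in querySet l).

Let cT : #|T| = l. Proof. by move: qT; rewrite inE => /andP[_ /eqP]. Qed.

Let l_gt0 : 0 < l%:R :> R. Proof. by rewrite ltr0n ltnW. Qed.

Let exists_best : exists2 A, A \in demoD l & #|A :&: T| = l./2.
Proof.
have [|T1 sT1 cT1] := @subset_of_card _ T l./2; first by rewrite cT; lia.
have [|A [DA AT _]] := @exists_demo _ finset.set0 _ _ qT _ sT1 cT1.
  by rewrite finset.set0I cards0.
by exists A => //; rewrite AT.
Qed.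

Let loss_best A B : A \in demoD l -> B \in demoD l ->
  #|A :&: T| = l./2 -> #|B :&: T| = l./2 ->
  loss_of R T [:: A; B] = pair_loss l%:R #|A :&: B|%:R.
Proof.
move=> DA DB AT BT; apply: loss_of_pair; rewrite ?AT ?BT ?even_halfK //.
- exact: ltnW.
- exact: card_demo.
- exact: card_demo.
Qed.

Let Sim_demo A : A \in demoD l ->
  Sim (ind R A) (ind R T) = #|A :&: T|%:R / l%:R.
Proof. by move=> DA; rewrite Sim_ind // card_demo. Qed.

Lemma topkdiv_loss alpha : 0 < alpha -> alpha < 1 ->
  topkdiv_avg (ind R (l:=l)) (demoD l) 2 alpha (ind R T) (loss_of R T) =
  pair_loss l%:R 0.
Proof.
move=> a0 a1; have [A0 DA0 A0T] := exists_best.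
apply: (@greedy_avgS_const _ _ _ _ _ _ _ _ A0) => // A DA _ maxA.
(* [Div] against the empty list is 0, so the first score is [alpha] times similarity, and comparison
   with [A0] forces the maximal overlap. *)
have AT : #|A :&: T| = l./2.
  apply/eqP; rewrite eqn_leq card_demo_query //= -A0T.
  have := maxA A0 DA0 isT; rewrite /topkdiv_score /Div !Sim_demo // !mulr0 !addr0.
  by rewrite ler_pM2l // ler_pM2r ?invr_gt0 // ler_nat.
(* [T :\: A] has exactly the size of a low part. It yields a competitor [B0] with maximal similarity
   and no overlap with [A]. *)
have cTA : #|T :\: A| = l./2.
  by have := cardsID A T; rewrite cT finset.setIC AT; lia.
have [|B0 [DB0 B0T B0A]] := @exists_demo _ A _ _ qT _ (finset.subsetDl T A) cTA.
  by case/demoDP: DA => _ ->.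
have {}B0A : #|B0 :&: A| = 0%N.
  by rewrite B0A finset.setIC finset.setIDA finset.setDIl finset.setDv
    finset.set0I cards0.
have B0_neq_A : B0 \notin [:: A].
  rewrite inE; apply: contra_eqN B0A => /eqP ->.
  by rewrite finset.setIid card_demo // -lt0n ltnW.
apply: (@greedy_avgS_const _ _ _ _ _ _ _ _ B0) => // B DB _ maxB /=.
have := maxB B0 DB0 B0_neq_A.
rewrite /topkdiv_score /Div /= !big_seq1 !divr1 !Sim_demo //.
rewrite !(@Sim_ind _ _ _ A) ?(@card_demo _ A)
  ?(@card_demo _ B) ?(@card_demo _ B0) //.
rewrite B0T cTA B0A mul0r subr0 => le_score.
have BT_le := card_demo_query DB qT.
have simT_le : #|B :&: T|%:R / l%:R <= l./2%:R / l%:R :> R.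
  by rewrite ler_pM2r ?invr_gt0 // ler_nat.
have simA_ge : 0 <= #|B :&: A|%:R / l%:R :> R by rewrite divr_ge0.
(* [B0] attains the bounds on both score terms, so [B] must too. Here [alpha < 1] forces zero
   overlap with [A]; below, [0 < alpha] forces maximal similarity. *)
have BA0 : #|B :&: A|%:R / l%:R = 0 :> R.
  move: le_score simT_le simA_ge.
  move: (_ / _) (_ / _) (_ / _) => x y z; nra.
have BT : #|B :&: T| = l./2.
  apply/eqP; rewrite eqn_leq BT_le /=.
  rewrite -(ler_nat R) -(ler_pM2r (x := l%:R^-1)) ?invr_gt0 //.
  move: le_score; rewrite BA0; move: (_ / _) (_ / _) => x y; nra.
rewrite loss_best // finset.setIC; congr pair_loss.
by move/eqP: BA0; rewrite mulf_eq0 invr_eq0 [l%:R == 0]gt_eqF // orbF => /eqP.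
Qed.

Let exists_best2 : exists A B,
  [/\ A \in demoD l, B \in demoD l, #|A :&: T| = l./2 & #|B :&: T| = l./2]
  /\ A != B /\ (0 < #|A :&: B|)%N.
Proof.
have [A DA AT] := exists_best.
have cAh : (#|A :&: highhalf l| <= l./2)%N by case/demoDP: (DA) => _ ->.
(* [B] keeps [A :&: T] and takes its high part outside [A], so the overlap is exactly [l./2]:
   positive since [1 < l], yet smaller than [#|A|]. *)
have [B [DB BT BA]] := exists_demo qT cAh (finset.subsetIr A T) AT.
have cBA : #|B :&: A| = l./2.
  by rewrite BA finset.setIAC finset.setIid AT.
exists A, B; split; first by rewrite BT.
split; last by rewrite finset.setIC cBA; lia.
by apply: contra_eqN cBA => /eqP ->; rewrite finset.setIid card_demo //; lia.
Qed.

Let topk_pair S : S \in topk_sets (ind R (l:=l)) (demoD l) 2 (ind R T) ->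
  exists A B, [/\ enum S = [:: A; B], A \in demoD l, B \in demoD l,
    #|A :&: T| = l./2 & #|B :&: T| = l./2].
Proof.
rewrite inE => /and3P[/fintype.subsetP SD /eqP cS /forall_inP maxS].
have best x : x \in S -> #|x :&: T| = l./2.
  move=> Sx; apply/eqP; rewrite eqn_leq card_demo_query ?SD //= leqNgt.
  apply/negP => ltx.
  (* If [x] were suboptimal, every optimal demonstration would lie in [S :\ x]. That set has one
     element, while [exists_best2] gives two distinct optimal ones. *)
  have memS y : y \in demoD l -> #|y :&: T| = l./2 -> y \in S :\ x.
    move=> Dy yT; rewrite !inE; apply/andP; split.
      by apply: contraTneq ltx => <-; rewrite yT ltnn.
    apply: contraLR ltx => Sy; rewrite -leqNgt -yT.
    have /forall_inP/(_ y) := maxS x Sx; rewrite inE Sy Dy => /(_ isT).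
    by rewrite (Sim_demo Dy) (Sim_demo (SD x Sx)) ler_pM2r ?invr_gt0 // ler_nat.
  have [A [B [[DA DB AT BT] [AB _]]]] := exists_best2.
  have /eqP/cards1P[z Sxz] : #|S :\ x| = 1%N.
    by have := cardsD1 x S; rewrite cS Sx => -[].
  have := memS A DA AT; have := memS B DB BT; rewrite Sxz => /set1P Bz /set1P Az.
  by rewrite Az Bz eqxx in AB.
have szS : size (enum S) = 2%N by rewrite -cardE.
have memS x : x \in enum S -> x \in S by rewrite mem_enum.
case: (enum S) szS memS => [|A [|B []]] //= _ memS.
have SA : A \in S by apply: memS; rewrite inE eqxx.
have SB : B \in S by apply: memS; rewrite !inE eqxx orbT.
by exists A, B; split; rewrite ?SD ?best.
Qed.

(** No admissible pair beats overlap 0, and the overlapping pair from [exists_best2] is admissible,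
    which makes the average strictly larger. *)
Lemma topk_loss :
  pair_loss l%:R 0 < topk_avg (ind R (l:=l)) (demoD l) 2 (ind R T) (loss_of R T).
Proof.
have [A [B [[DA DB AT BT] [AB AB_gt0]]]] := exists_best2.
have topkAB : [set A; B]%SET \in topk_sets (ind R (l:=l)) (demoD l) 2 (ind R T).
  rewrite inE cards2 AB eqxx /= finset.subUset !finset.sub1set DA DB /=.
  apply/forall_inP => x xAB; apply/forall_inP => y; rewrite inE => /andP[_ Dy].
  have [Dx xT] : x \in demoD l /\ #|x :&: T| = l./2.
    by case/set2P: xAB => ->.
  by rewrite !Sim_demo // ler_pM2r ?invr_gt0 // ler_nat xT card_demo_query.
apply: (avg_gt _ topkAB) => [S /topk_pair [A' [B' [-> DA' DB' A'T B'T]]]|].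
  by rewrite loss_best // pair_loss_le.
(* [enum] may list the pair in either order; the overlap is symmetric. *)
have [A' [B' [ES DA' DB' A'T B'T]]] := topk_pair topkAB.
rewrite ES loss_best // pair_loss_lt // ltr0n.
have : uniq [:: A'; B'] by rewrite -ES enum_uniq.
have /set2P A'E : A' \in [set A; B]%SET by rewrite -mem_enum ES mem_head.
have /set2P B'E : B' \in [set A; B]%SET
  by rewrite -mem_enum ES in_cons mem_head orbT.
rewrite /= mem_seq1 andbT.
by case: A'E => ->; case: B'E => ->; rewrite ?eqxx // finset.setIC.
Qed.

End Fixed_query.

Theorem theorem1 (R : realType) (l : nat) (hl : (200 <= l)%N) (hev : ~~ odd l)
  (alpha : R) (ha0 : 0 < alpha) (ha1 : alpha < 1) :
  L_topkdiv l 2 alpha < L_topk R l 2.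
Proof.
have l_gt1 : (1 < l)%N by apply: leq_trans hl.
(* A query exists, so the average over [querySet] is not over the empty set and the comparison can
   be made query by query. *)
have [|T sT cT] := @subset_of_card _ (lowhalf l) l.
  by rewrite card_lowhalf leq_pmull.
have qT : T \in querySet l by rewrite inE sT cT eqxx.
rewrite /L_topkdiv /avg_query (@avg_const _ _ _ _ (pair_loss l%:R 0)).
- apply: (avg_gt _ qT) => [T' qT'|]; last exact: topk_loss.
  exact/ltW/topk_loss.
- by apply/set0Pn; exists T.
- by move=> T' qT'; apply: topkdiv_loss.
Qed.
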